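(* For all $\boldsymbol\nu\in\mathbb N_0^s\setminus\{\mathbf 0\}$ there holds $$ \big|\partial_{\boldsymbol\theta}^{\boldsymbol\nu}\,{\rm e}^{-\frac12\|\boldsymbol y-G_s(\boldsymbol\theta,\boldsymbol\xi)\|_{\Gamma^{-1}}^2}\big|\leq 3.82^k\cdot C^{|\boldsymbol\nu|}\,2^{\beta(|\boldsymbol\nu|-1)}\,\mu_{\min}^{-|\boldsymbol\nu|/2}\,(|\boldsymbol\nu|!)^{\beta}\,\boldsymbol b^{\boldsymbol\nu} $$ for all $\boldsymbol\theta\in\Theta_s$, $\boldsymbol y\in[-K,K]^k$, and $\boldsymbol\xi\in\Xi$.
   Context: Notation: for $\boldsymbol\nu\in\mathbb N_0^s$, $|\boldsymbol\nu|=\sum_j\nu_j$, $\boldsymbol b^{\boldsymbol\nu}=\prod_{j=1}^s b_j^{\nu_j}$ (with $0^0=1$), $\partial_{\boldsymbol\theta}^{\boldsymbol\nu}=\prod_j\partial^{\nu_j}/\partial\theta_j^{\nu_j}$. $\|\cdot\|$ is the Euclidean norm and $\|\boldsymbol x\|_{\Gamma^{-1}}=\sqrt{\boldsymbol x^{\rm T}\Gamma^{-1}\boldsymbol x}$. Standing assumptions: $k\in\mathbb N$, $K>0$, $s\in\mathbb N$; $\Xi$ is a compact subset of a Euclidean space (design space); $\Theta_s=[-\frac12,\frac12]^s$. $\Gamma\in\mathbb R^{k\times k}$ is symmetric positive definite and $0<\mu_{\min}\le 1$ is a lower bound on its smallest eigenvalue. $C\ge1$ and $\beta\ge1$ are constants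 and $\boldsymbol b=(b_j)_{j\ge1}\in\ell^p(\mathbb N)$, for some $p\in(0,1)$, is a sequence of nonnegative real numbers, all independent of $s$ and $\boldsymbol\xi$. The forward models $G_s:\Theta_s\times\Xi\to\mathbb R^k$, $s\in\mathbb N$, are smooth in $\boldsymbol\theta$ and satisfy $\|\partial_{\boldsymbol\theta}^{\boldsymbol\nu}G_s(\boldsymbol\theta,\boldsymbol\xi)\|\le C(|\boldsymbol\nu|!)^{\beta}\boldsymbol b^{\boldsymbol\nu}$ for all $\boldsymbol\theta\in\Theta_s$, $\boldsymbol\nu\in\mathbb N_0^s$, $\boldsymbol\xi\in\Xi$. *)

(* Defs.v *)
From HB Require Import structures.
From mathcomp Require Import all_boot all_order all_algebra.
From mathcomp Require Import all_classical all_reals all_analysis.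

Set Implicit Arguments.
Unset Strict Implicit.
Unset Printing Implicit Defensive.

Import Order.TTheory GRing.Theory Num.Theory.
Import numFieldNormedType.Exports.

Local Open Scope classical_set_scope.
Local Open Scope ring_scope.

(* The library norm of matrices is the sup norm, hence the definition below. *)
Definition enorm (R : realType) (k : nat) (x : 'cV[R]_k) : R :=
  Num.sqrt (\sum_(i < k) x i 0 ^+ 2).

Definition wnorm (R : realType) (k : nat) (A : 'M[R]_k) (x : 'cV[R]_k) : R :=
  Num.sqrt ((x^T *m A *m x) 0 0).

Definition posdefmx (R : realType) (k : nat) (A : 'M[R]_k) : Prop :=
  forall x : 'cV[R]_k, x != 0 -> 0 < (x^T *m A *m x) 0 0.

Definition cube (R : realType) (s : nat) : set 'rV[R]_s :=
  [set x | forall j : 'I_s, - (1 / 2) <= x 0 j <= 1 / 2].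

Definition mi_order (s : nat) (nu : {ffun 'I_s -> nat}) : nat :=
  (\sum_(j < s) nu j)%N.

(* The sequence b is indexed from 0: [b j] goes with the coordinate [j : 'I_s]. *)
Definition mi_pow (R : realType) (s : nat) (b : nat -> R)
    (nu : {ffun 'I_s -> nat}) : R :=
  \prod_(j < s) b j ^+ nu j.

(* Partial derivatives relative to D: the increment h ranges over the nonzero
   reals keeping x + h e_j in D, so that at a boundary point of a cube this is
   the one-sided derivative, and values of f outside D play no role.  At an
   interior point of D it is the usual partial derivative. *)
Definition partial_quotient (R : realType) (s : nat) (V : normedModType R)
    (f : 'rV[R]_s -> V) (x : 'rV[R]_s) (j : 'I_s) (h : R) : V :=
  h^-1 *: (f (x + h *: delta_mx 0 j) - f x).

Definition partial_filter (R : realType) (s : nat) (D : set 'rV[R]_s)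
    (x : 'rV[R]_s) (j : 'I_s) : set_system R :=
  within [set h | D (x + h *: delta_mx 0 j)] 0^'.

Definition partial (R : realType) (s : nat) (V : normedModType R)
    (D : set 'rV[R]_s) (j : 'I_s) (f : 'rV[R]_s -> V) : 'rV[R]_s -> V :=
  fun x => lim (partial_quotient f x j @ partial_filter D x j).

Definition partial_ex (R : realType) (s : nat) (V : normedModType R)
    (D : set 'rV[R]_s) (j : 'I_s) (f : 'rV[R]_s -> V) (x : 'rV[R]_s) : Prop :=
  cvg (partial_quotient f x j @ partial_filter D x j).

Definition smooth_on (R : realType) (s : nat) (V : normedModType R)
    (D : set 'rV[R]_s) (f : 'rV[R]_s -> V) : Prop :=
  forall js : seq 'I_s,
    let g := foldr (partial D) f js in
    {within D, continuous g} /\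
    (forall (j : 'I_s) (x : 'rV[R]_s), D x -> partial_ex D j g x).

(* d_0^{nu_0} (d_1^{nu_1} (... f)); for functions that are smooth on D the order
   of the differentiations is immaterial. *)
Definition mi_partial (R : realType) (s : nat) (V : normedModType R)
    (D : set 'rV[R]_s) (nu : {ffun 'I_s -> nat}) (f : 'rV[R]_s -> V) :
    'rV[R]_s -> V :=
  foldr (fun j g => iter (nu j) (partial D j) g) f (enum 'I_s).

(* Main.v *)
(* Write Gamma^-1 = L^T L (Cholesky) and g = L (y - G), so that the function to be
   differentiated is the product over i of phi (g_i) with phi x = exp (- x^2 / 2).  As the
   eigenvalues of Gamma are at least mu_min, the derivatives of every g_i are bounded by
   A (n!)^beta b^nu with A = C mu_min^(-1/2).

   The m-th derivative of phi is bounded by m! r^m with r = 73/100: the energy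
   (m + 1) (phi^(m))^2 + (phi^(m+1))^2 is maximal at 0 because phi^(m) solves
   v'' + x v' + (m + 1) v = 0.

   In Faa di Bruno's formula for a derivative of order n, the partitions into m blocks
   contribute, by these two bounds, at most (n!)^beta b^nu A^m 'C(n-1, m-1) times
   r^m 'C(k+m-1, m).  The last factor is at most (1 - r)^-k = (100/27)^k <= 3.82^k by
   the binomial theorem, and the binomials 'C(n-1, m-1) sum to 2^(n-1). *)
Require Import Defs.
From HB Require Import structures.
From mathcomp Require Import all_boot all_order all_algebra.
From mathcomp Require Import all_classical all_reals all_analysis.
From mathcomp Require Import ring lra.

Set Implicit Arguments.
Unset Strict Implicit.
Unset Printing Implicit Defensive.

Import Order.TTheory GRing.Theory Num.Theory.
Import numFieldNormedType.Exports.

Local Open Scope classical_set_scope.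
Local Open Scope ring_scope.

(** * Partial derivatives on the closed cube *)

Section PartialDerivatives.
Variables (R : realType) (s : nat).
Implicit Types (x : 'rV[R]_s) (j : 'I_s) (js : seq 'I_s).

Local Notation D := (@cube R s).

(** Existence and value in one relation: [partial] is a [lim], which tells the derivative only once
    convergence is known. *)
Definition has_partial (V : normedModType R) (f : 'rV[R]_s -> V) x j (l : V) :=
  partial_quotient f x j @ partial_filter D x j --> l.

Lemma partial_filter_filter x j : Filter (partial_filter D x j).
Proof. by apply: within_filter; apply: nbhs_filter. Qed.
#[local] Existing Instance partial_filter_filter.

(** A small step along [j] towards the centre stays inside the cube, even from a boundary point.
    Properness makes limits unique. *)
Lemma partial_filter_proper x j : D x -> ProperFilter (partial_filter D x j).
Proof.
move=> Dx; apply: Build_ProperFilter_ex => P.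
rewrite /partial_filter /within /= => -[e /= e0 He].
pose m := Num.min (e / 2) (1 / 2).
have m0 : 0 < m by rewrite lt_min; apply/andP; split; lra.
have me : m < e by rewrite gt_min; apply/orP; left; lra.
have m1 : m <= 1 / 2 by rewrite ge_min lexx orbT.
pose h := if x 0 j <= 0 then m else - m.
exists h; apply: (He h).
- by rewrite /ball_/= sub0r normrN /h; case: ifP => _; rewrite ?normrN gtr0_norm.
- by rewrite /h; case: ifP => _; rewrite ?oppr_eq0 gt_eqF.
move=> i; rewrite !mxE eqxx /=; have /andP[xi1 xi2] := Dx i.
case: (eqVneq i j) xi1 xi2 => [->|ij] /=; rewrite ?mulr0 ?addr0; last first.
  by move=> -> ->.
rewrite /h mulr1; case: ifP => [|/negbT]; rewrite -?ltNge => *; apply/andP; split; lra.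
Qed.

Section Normed.
Variable V : normedModType R.
Implicit Types (f g : 'rV[R]_s -> V).

Lemma has_partialE f x j l : D x -> has_partial f x j l -> partial D j f x = l.
Proof.
move=> Dx fl; have := partial_filter_proper j Dx => PF.
exact: (@cvg_lim _ (@norm_hausdorff _ V) _ _ _ _ _ fl).
Qed.

Lemma has_partial_ex f x j l : has_partial f x j l -> partial_ex D j f x.
Proof. by move=> h; apply/cvg_ex; exists l. Qed.

Lemma has_partial_ext f g x j l : D x -> {in D, f =1 g} ->
  has_partial f x j l -> has_partial g x j l.
Proof.
move=> Dx fg; apply: cvg_trans; apply: near_eq_cvg.
rewrite /partial_filter near_withinE; apply: nearW => h Dh.
by rewrite /partial_quotient !fg // inE.
Qed.

Lemma has_partialD f g x j a b : has_partial f x j a -> has_partial g x j b ->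
  has_partial (fun t => f t + g t) x j (a + b).
Proof.
move=> fa gb; apply: cvg_trans (cvgD fa gb); apply: near_eq_cvg.
apply: nearW => h; rewrite /partial_quotient /= fctE.
by rewrite -scalerDr opprD addrACA.
Qed.

Lemma has_partial_cst (c : V) x j : has_partial (fun=> c) x j 0.
Proof.
rewrite /has_partial (_ : partial_quotient _ _ _ = cst 0); first exact: cvg_cst.
by apply/funext => h; rewrite /partial_quotient subrr scaler0.
Qed.

Lemma partial_filter0 x j : (fun h : R => h) @ partial_filter D x j --> (0 : R).
Proof.
by move=> P [e /= e0 He]; exists e => //= y ye _ _; exact: (He y ye).
Qed.

(** For [h != 0] the shifted value is [h] times the difference quotient plus [f x]. The product and
    chain rules use this continuity along the axis. *)
Lemma has_partial_cvg f x j l : has_partial f x j l ->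
  f (x + h *: delta_mx 0 j) @[h --> partial_filter D x j] --> f x.
Proof.
move=> fl.
have H : (fun h : R => h *: partial_quotient f x j h + f x) @ partial_filter D x j
    --> 0 *: l + f x.
  exact: cvgD (cvgZ (@partial_filter0 x j) fl) (cvg_cst (f x)).
move: H.
rewrite scale0r add0r; apply: cvg_trans; apply: near_eq_cvg.
rewrite /partial_filter near_withinE.
exists 1 => //= h _ h0 _ /=.
by rewrite /partial_quotient scalerA divff // scale1r subrK.
Qed.

End Normed.

Lemma has_partialM (f g : 'rV[R]_s -> R) x j a b :
  has_partial f x j a -> has_partial g x j b ->
  has_partial (fun t => f t * g t) x j (a * g x + f x * b).
Proof.
move=> fa gb.
have H : (fun h => partial_quotient f x j h * g (x + h *: delta_mx 0 j)
    + f x * partial_quotient g x j h) @ partial_filter D x j --> a * g x + f x * b.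
  exact: cvgD (cvgM fa (has_partial_cvg gb)) (cvgM (cvg_cst (f x)) gb).
move: H.
apply: cvg_trans; apply: near_eq_cvg; apply: nearW => h.
by rewrite /partial_quotient /= /GRing.scale /=; ring.
Qed.

Lemma has_partial_linear (V : normedModType R) (L : V -> R)
    (f : 'rV[R]_s -> V) x j l : linear L -> {for l, continuous L} ->
  has_partial f x j l -> has_partial (fun t => L (f t)) x j (L l).
Proof.
move=> lL cL fl; have := cvg_comp _ _ fl cL; apply: cvg_trans.
apply: near_eq_cvg; apply: nearW => h; rewrite /partial_quotient /=.
pose L' : {linear V -> R} := HB.pack L (GRing.isLinear.Build R V R *%R L lL).
by rewrite -![L _]/(L' _) linearZ linearB.
Qed.

(** Caratheodory's form of the derivative of [phi] avoids dividing by an increment of [g], which may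
    vanish. *)
Lemma has_partial_comp (phi : R -> R) (g : 'rV[R]_s -> R) x j d l :
  is_derive (g x) 1 phi d -> has_partial g x j l ->
  has_partial (fun t => phi (g t)) x j (d * l).
Proof.
move=> /is_derive1_caratheodory[q [qE qc <-]] gl.
have H : (fun h => q (g (x + h *: delta_mx 0 j)) * partial_quotient g x j h)
    @ partial_filter D x j --> q (g x) * l.
  exact: cvgM (cvg_comp _ _ (has_partial_cvg gl) qc) gl.
move: H.
apply: cvg_trans; apply: near_eq_cvg; apply: nearW => h.
by rewrite /partial_quotient /= /GRing.scale /= qE; ring.
Qed.
End PartialDerivatives.

(** * Iterated partial derivatives and a Leibniz bound *)

Section IteratedPartials.
Variables (R : realType) (s : nat).
Implicit Types (x : 'rV[R]_s) (j : 'I_s) (js : seq 'I_s) (f g : 'rV[R]_s -> R).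

Local Notation D := (@cube R s).

Fixpoint diff_upto (n : nat) (f : 'rV[R]_s -> R) : Prop :=
  if n is n'.+1 then
    (forall j x, D x -> partial_ex D j f x) /\
    (forall j, diff_upto n' (partial D j f))
  else True.

Lemma partial_ext j f g : (forall x, D x -> partial_ex D j f x) ->
  {in D, f =1 g} -> {in D, partial D j f =1 partial D j g}.
Proof.
move=> fx fg x /set_mem Dx; apply/esym/has_partialE => //.
by apply: has_partial_ext fg _ => //; exact: fx.
Qed.

Lemma diff_upto_ext n f g : {in D, f =1 g} -> diff_upto n f -> diff_upto n g.
Proof.
elim: n f g => //= n IH f g fg [fx fn]; split => [j x Dx|j].
  by apply/has_partial_ex/(has_partial_ext Dx fg); apply: fx.
by apply: IH (fn j); apply: partial_ext => // x; apply: fx.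
Qed.

Lemma diff_uptoW n f : diff_upto n.+1 f -> diff_upto n f.
Proof.
elim: n f => // n IH f [fx fn]; split=> // j; exact/IH/fn.
Qed.

Lemma diff_upto_step n f (f' : 'I_s -> 'rV[R]_s -> R) :
  (forall j x, D x -> has_partial f x j (f' j x)) ->
  (forall j, diff_upto n (f' j)) -> diff_upto n.+1 f.
Proof.
move=> ff' f'n; split => [j x Dx|j]; first exact/has_partial_ex/ff'.
apply: diff_upto_ext (f'n j) => x /set_mem Dx.
by apply/esym/has_partialE => //; apply: ff'.
Qed.

Lemma diff_uptoD n f g : diff_upto n f -> diff_upto n g ->
  diff_upto n (fun t => f t + g t).
Proof.
elim: n f g => // n IH f g [fx fn] [gx gn].
apply: (@diff_upto_step _ _ (fun j t => partial D j f t + partial D j g t)).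
  by move=> j x Dx; apply: has_partialD; [apply: fx | apply: gx].
by move=> j; apply: IH; [apply: fn | apply: gn].
Qed.

Lemma diff_upto_cst n (c : R) : diff_upto n (fun=> c).
Proof.
elim: n c => // n IH c.
by apply: (@diff_upto_step _ _ (fun j t => 0)) => // j x _; apply: has_partial_cst.
Qed.

Lemma diff_upto_sum n (I : Type) (r : seq I) (f : I -> 'rV[R]_s -> R) :
  (forall i, diff_upto n (f i)) -> diff_upto n (fun t => \sum_(i <- r) f i t).
Proof.
move=> fn; elim: r => [|i r IH].
  by under eq_fun do rewrite big_nil; apply: diff_upto_cst.
by under eq_fun do rewrite big_cons; apply: diff_uptoD.
Qed.

Lemma diff_uptoM n f g : diff_upto n f -> diff_upto n g ->
  diff_upto n (fun t => f t * g t).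
Proof.
elim: n f g => // n IH f g fn gn.
have [[fx f'n] [gx g'n]] := (fn, gn).
apply: (@diff_upto_step _ _
  (fun j t => partial D j f t * g t + f t * partial D j g t)).
  by move=> j x Dx; apply: has_partialM; [apply: fx | apply: gx].
by move=> j; apply: diff_uptoD; apply: IH; by [apply: f'n | apply: g'n | apply: diff_uptoW].
Qed.

(** In this [foldr] the last index of [js] is differentiated first, whence the inductions by
    [last_ind]. *)
Definition partials (V : normedModType R) js (f : 'rV[R]_s -> V) :=
  foldr (partial D) f js.

Lemma partials_rcons (V : normedModType R) js j (f : 'rV[R]_s -> V) :
  partials (rcons js j) f = partials js (partial D j f).
Proof. by rewrite /partials foldr_rcons. Qed.

Lemma partials_ext js f g : diff_upto (size js) f -> {in D, f =1 g} ->
  {in D, partials js f =1 partials js g}.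
Proof.
elim/last_ind: js f g => // js j IH f g.
rewrite size_rcons !partials_rcons => -[fx fn] fg.
by apply: IH; [apply: fn | apply: partial_ext => // x; apply: fx].
Qed.

Lemma partialsD js f g : diff_upto (size js) f -> diff_upto (size js) g ->
  {in D, partials js (fun t => f t + g t) =1
         (fun t => partials js f t + partials js g t)}.
Proof.
elim/last_ind: js f g => // js j IH f g.
rewrite size_rcons !partials_rcons => -[fx fn] [gx gn] x Dx.
rewrite -(IH _ _ (fn j) (gn j)) //; apply/esym/partials_ext => //.
  exact: diff_uptoD (fn j) (gn j).
move=> y /set_mem Dy; apply/esym/has_partialE => //.
by apply: has_partialD; [apply: fx | apply: gx].
Qed.

Lemma partials0 js : {in D, partials js (fun=> 0 : R) =1 (fun=> 0)}.
Proof.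
elim/last_ind: js => // js j IH x Dx; rewrite partials_rcons -[RHS](IH x Dx).
apply/esym/partials_ext => //; first exact: diff_upto_cst.
by move=> y /set_mem Dy; apply/esym/has_partialE => //; apply: has_partial_cst.
Qed.

Lemma partials_sum (I : Type) (r : seq I) js (f : I -> 'rV[R]_s -> R) :
  (forall i, diff_upto (size js) (f i)) ->
  {in D, partials js (fun t => \sum_(i <- r) f i t) =1
         (fun t => \sum_(i <- r) partials js (f i) t)}.
Proof.
move=> fn x Dx; elim: r => [|i r IH].
  by under eq_fun do rewrite big_nil; rewrite big_nil partials0.
under eq_fun do rewrite big_cons; rewrite big_cons partialsD ?IH //.
exact: diff_upto_sum.
Qed.

(** The induction step of Leibniz' formula: [F p q] stands for the term with [p] derivatives on the
    first factor and [q] on the second. *)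
Lemma pascal_sum n (F : nat -> nat -> R) :
  \sum_(r < n.+2) 'C(n.+1, r)%:R * F r (n.+1 - r)%N =
  \sum_(r < n.+1) 'C(n, r)%:R * F r.+1 (n - r)%N +
  \sum_(r < n.+1) 'C(n, r)%:R * F r (n - r).+1.
Proof.
rewrite big_ord_recl /= subn0 bin0.
have -> : \sum_(r < n.+1) 'C(n, r)%:R * F r (n - r).+1 =
    \sum_(r < n.+2) 'C(n, r)%:R * F r (n.+1 - r)%N.
  rewrite [RHS]big_ord_recr /= bin_small // mul0r addr0.
  by apply: eq_bigr => i _; rewrite subSn // -ltnS.
rewrite [X in _ = _ + X]big_ord_recl /= subn0 bin0 [RHS]addrCA; congr (_ + _).
rewrite -big_split /=; apply: eq_bigr => i _.
by rewrite /bump /= add1n subSS binS natrD mulrDl addrC.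
Qed.

Variable b : nat -> R.
Hypothesis b_ge0 : forall j, 0 <= b j.

(** The monomial [b^nu], with [nu] counting the occurrences in [js]. *)
Definition weight js := \prod_(j <- js) b j.

Lemma weight_rcons js j : weight (rcons js j) = weight js * b j.
Proof. by rewrite /weight -cats1 big_cat big_seq1. Qed.

Lemma weight_ge0 js : 0 <= weight js.
Proof. exact: prodr_ge0. Qed.

Lemma subseq_rcons_rcons js js' j : subseq js' js -> subseq (rcons js' j) (rcons js j).
Proof. by move=> ss; rewrite -!cats1 cat_subseq. Qed.

(** In Leibniz' formula each factor receives a subsequence of [js]. Up to [weight] the bounds depend
    on its length only, so the splittings are grouped by length and counted by binomials. *)
Lemma partials_mul_le x js (u v : 'rV[R]_s -> R) (U V : nat -> R) : D x ->
  diff_upto (size js) u -> diff_upto (size js) v ->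
  (forall js', subseq js' js -> `|partials js' u x| <= U (size js') * weight js') ->
  (forall js', subseq js' js -> `|partials js' v x| <= V (size js') * weight js') ->
  `|partials js (fun t => u t * v t) x| <=
  (\sum_(r < (size js).+1) 'C(size js, r)%:R * (U r * V (size js - r)%N)) *
  weight js.
Proof.
move=> Dx; elim/last_ind: js u v U V => [|js j IH] u v U V /=.
  move=> _ _ /(_ [::] isT) uU /(_ [::] isT) vV; move: uU vV.
  rewrite /weight big_nil big_ord_recl big_ord0 /= bin0 addr0 !mulr1 mul1r normrM.
  exact: ler_pM.
rewrite size_rcons => un vn uU vV.
have [[ux u'n] [vx v'n]] := (un, vn).
rewrite partials_rcons.
have -> : partials js (partial D j (fun t => u t * v t)) x =
    partials js (fun t => partial D j u t * v t) x +
    partials js (fun t => u t * partial D j v t) x.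
  rewrite -partialsD ?inE //; try by apply: diff_uptoM;
    by [apply: u'n | apply: v'n | apply: diff_uptoW].
  apply/esym/partials_ext; rewrite ?inE //.
    by apply: diff_uptoD; apply: diff_uptoM; by [apply: u'n | apply: v'n | apply: diff_uptoW].
  move=> y /set_mem Dy; apply/esym/has_partialE => //.
  by apply: has_partialM; [apply: ux | apply: vx].
rewrite (pascal_sum _ (fun p q => U p * V q)) mulrDl.
apply: le_trans (ler_normD _ _) _; apply: lerD.
  (* The factor [b j] is absorbed into the shifted bound [U], which gives the sum the shape of the
     induction hypothesis. *)
  have -> : (\sum_(r < (size js).+1) 'C(size js, r)%:R * (U r.+1 * V (size js - r)%N))
      * weight (rcons js j) = (\sum_(r < (size js).+1)
      'C(size js, r)%:R * (U r.+1 * b j * V (size js - r)%N)) * weight js.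
    by rewrite weight_rcons !mulr_suml; apply: eq_bigr => i _; ring.
  apply: (IH _ _ (fun n => U n.+1 * b j) V (u'n j) (diff_uptoW vn)) => js' ss.
  - rewrite -partials_rcons; apply: le_trans (uU _ (subseq_rcons_rcons j ss)) _.
    by rewrite size_rcons weight_rcons [weight _ * _]mulrC mulrA.
  - by apply: vV; apply: subseq_trans ss (subseq_rcons _ _).
have -> : (\sum_(r < (size js).+1) 'C(size js, r)%:R * (U r * V (size js - r).+1))
    * weight (rcons js j) = (\sum_(r < (size js).+1)
    'C(size js, r)%:R * (U r * (V (size js - r).+1 * b j))) * weight js.
  by rewrite weight_rcons !mulr_suml; apply: eq_bigr => i _; ring.
apply: (IH _ _ U (fun n => V n.+1 * b j) (diff_uptoW un) (v'n j)) => js' ss.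
- by apply: uU; apply: subseq_trans ss (subseq_rcons _ _).
- rewrite -partials_rcons; apply: le_trans (vV _ (subseq_rcons_rcons j ss)) _.
  by rewrite size_rcons weight_rcons [weight _ * _]mulrC mulrA.
Qed.

End IteratedPartials.

(** * Hermite functions and the derivatives of the Gaussian *)

Section HermiteFunctions.
Variable R : realType.
Implicit Types (x : R) (n l : nat).

(* [hermite n] is (-1)^n times the probabilists' Hermite polynomial. *)
Fixpoint hermite (n : nat) : {poly R} :=
  if n is n'.+1 then (hermite n')^`() - 'X * hermite n' else 1.

Lemma deriv_hermite n : (hermite n.+1)^`() = - n.+1%:R *: hermite n.
Proof.
elim: n => [|n IH].
  by rewrite /= derivC sub0r mulr1 derivN derivX scaleN1r.
rewrite [hermite n.+2]/= -/(hermite n.+1) derivB IH derivZ derivM derivX mul1r IH.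
rewrite [hermite n.+1]/= -!mul_polyC !polyCN [n.+2%:R]mulrS polyCD.
by ring.
Qed.

Lemma hermite_rec n :
  hermite n.+2 = - ('X * hermite n.+1) - n.+1%:R *: hermite n.
Proof. by rewrite [LHS]/= -/(hermite n.+1) deriv_hermite scaleNr addrC. Qed.

(** The [l]-th derivative of [exp (- x^2 / 2)], by [is_derive_gauss]. *)
Definition gauss (l : nat) (x : R) : R := (hermite l).[x] * expR (- (1 / 2) * x ^+ 2).

Arguments gauss : simpl never.

Lemma gauss_rec l x : gauss l.+2 x = - x * gauss l.+1 x - l.+1%:R * gauss l x.
Proof.
rewrite /gauss hermite_rec; move: (hermite l.+1) (hermite l) => p q.
by rewrite !(hornerD, hornerN, hornerM, hornerX, hornerZ); ring.
Qed.

Lemma is_derive_gauss l x : is_derive x 1 (gauss l) (gauss l.+1 x).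
Proof.
have H1 : is_derive x 1 (fun y : R => (hermite l).[y]) (hermite l)^`().[x].
  exact: is_derive_poly.
have H2 : is_derive x 1 (fun y : R => expR (- (1 / 2) * y ^+ 2))
    (expR (- (1 / 2) * x ^+ 2) * - x).
  apply: is_derive1_comp.
  by apply: is_derive_eq; rewrite /GRing.scale /=; lra.
have -> : gauss l.+1 x = (hermite l).[x] *: (expR (- (1 / 2) * x ^+ 2) * - x)
    + expR (- (1 / 2) * x ^+ 2) *: (hermite l)^`().[x].
  rewrite /gauss [hermite l.+1]/=; move: (hermite l) => p.
  rewrite !(hornerD, hornerN, hornerM, hornerX) /GRing.scale /=; ring.
exact: is_deriveM.
Qed.

Definition energy l x := l.+1%:R * gauss l x ^+ 2 + gauss l.+1 x ^+ 2.

(** The cross terms cancel by [gauss_rec]; what remains changes sign only at 0. *)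
Lemma is_derive_energy l x :
  is_derive x 1 (energy l) (- (2 * x * gauss l.+1 x ^+ 2)).
Proof.
have H1 := is_derive_gauss l x; have H2 := is_derive_gauss l.+1 x.
apply: is_derive_eq.
rewrite gauss_rec; move: (gauss l.+1 x) (gauss l x) => u v.
rewrite /GRing.scale /=; ring.
Qed.

Lemma energy_le l x : energy l x <= energy l 0.
Proof.
have dE y : derivable (energy l) y 1 by have [] := is_derive_energy l y.
have cE y z : {within `[y, z], continuous (energy l)}.
  by apply: derivable_within_continuous.
have E' y : derive1 (energy l) y = - (2 * y * gauss l.+1 y ^+ 2).
  by rewrite derive1E; have [] := is_derive_energy l y.
have [x0|/ltW x0] := leP 0 x.
  apply: (@ler0_derive1_nincr _ (energy l) 0 x) => //.
  move=> y /itvP y0; rewrite E' oppr_le0 mulr_ge0 ?sqr_ge0 // mulr_ge0 //.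
  by rewrite y0.
apply: (@ger0_derive1_ndecr _ (energy l) x 0) => //.
move=> y /itvP y0; rewrite E' oppr_ge0 mulr_le0_ge0 ?sqr_ge0 //.
by rewrite mulr_ge0_le0 // y0.
Qed.

(** At 0 the recursion [gauss_rec] links orders two apart, so the induction has step two. Orders 1
    and 2 need [r^2 >= 1/2], while [(1 - r)^-1 <= 3.82] needs [r <= 0.738...]; the value 73/100 lies
    in between. *)
Lemma energy0_le l :
  energy l 0 <= l.+1%:R * (l`!%:R * (73%:R / 100%:R) ^+ l) ^+ 2.
Proof.
have g0 : gauss 0 0 = 1 by rewrite /gauss /= hornerC expr0n mulr0 expR0 mulr1.
have g1 : gauss 1 0 = 0 by rewrite /gauss /= (derivC 1) sub0r mulr1 hornerN hornerX
  oppr0 mul0r.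
have gS n : gauss n.+2 0 = - (n.+1%:R * gauss n 0).
  by rewrite gauss_rec oppr0 mul0r sub0r.
(* Order 0 stays outside the induction: the step from order [l] needs [(l + 1) (l + 3) r^4 >= 1],
   which fails for [l = 0]. *)
suff H n : energy n.+1 0 <= n.+2%:R * (n.+1`!%:R * (73%:R / 100%:R) ^+ n.+1) ^+ 2 /\
    energy n.+2 0 <= n.+3%:R * (n.+2`!%:R * (73%:R / 100%:R) ^+ n.+2) ^+ 2.
  case: l => [|l]; last by have [] := H l.
  by rewrite /energy g0 g1 fact0 expr0; lra.
elim: n => [|n [IH1 IH2]].
  by rewrite /energy !gS g0 g1 !factS fact0 expr2 /=; split; lra.
split=> //.
set N : R := n%:R; have N0 : 0 <= N by rewrite ler0n.
have N2 : n.+2%:R = N + 2 :> R by rewrite -addn2 natrD.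
have N3 : n.+3%:R = N + 3 :> R by rewrite -addn3 natrD.
have N4 : n.+4%:R = N + 4 :> R by rewrite -addn4 natrD.
have -> : energy n.+3 0 = (N + 4) * ((N + 2) * gauss n.+1 0) ^+ 2
    + ((N + 3) * gauss n.+2 0) ^+ 2.
  by rewrite /energy (gS n.+1) (gS n.+2) !sqrrN N2 N3 N4.
move: IH1; rewrite /energy.
have -> : n.+3`!%:R = (N + 3) * (N + 2) * n.+1`!%:R :> R.
  by rewrite (factS n.+2) (factS n.+1) !natrM mulrA N2 N3.
rewrite N4 N2.
set G1 := gauss n.+1 0 ^+ 2; set G2 := gauss n.+2 0 ^+ 2.
rewrite ![(73%:R / 100%:R) ^+ _.+1]exprS.
set Q : R := n.+1`!%:R; set S := _ ^+ n => IH.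
have G10 : 0 <= G1 by apply: sqr_ge0.
have -> : ((N + 2) * gauss n.+1 0) ^+ 2 = (N + 2) ^+ 2 * G1 by rewrite exprMn.
have -> : ((N + 3) * gauss n.+2 0) ^+ 2 = (N + 3) ^+ 2 * G2 by rewrite exprMn.
(* Here [(N + 4) (N + 2) <= (N + 3)^2] is used. *)
apply: (@le_trans _ _ ((N + 3) ^+ 2 * ((N + 2) * G1 + G2))).
  by nra.
apply: le_trans (ler_wpM2l (sqr_ge0 _) IH) _.
have W0 : 0 <= (Q * (73%:R / 100%:R * S)) ^+ 2 by apply: sqr_ge0.
have -> : (N + 4) * ((N + 3) * (N + 2) * Q *
  (73%:R / 100%:R * (73%:R / 100%:R * (73%:R / 100%:R * S)))) ^+ 2 =
  (N + 3) ^+ 2 * ((N + 2) * ((N + 4) * (N + 2) * (73%:R / 100%:R) ^+ 4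
     * (Q * (73%:R / 100%:R * S)) ^+ 2)) by ring.
apply: ler_wpM2l; first exact: sqr_ge0.
apply: ler_wpM2l; first lra.
apply: ler_peMl => //.
(* It remains that [(N + 4) (N + 2) r^4 >= 1]; already [8 r^4 > 2]. *)
rewrite (_ : (73%:R / 100%:R) ^+ 4 = 28398241%:R / 100000000%:R); last by field.
by nra.
Qed.

Lemma gauss_le l x : `|gauss l x| <= l`!%:R * (73%:R / 100%:R) ^+ l.
Proof.
have B0 : 0 <= l`!%:R * (73%:R / 100%:R) ^+ l :> R.
  by rewrite mulr_ge0 // exprn_ge0 // divr_ge0.
rewrite -(@ler_pXn2r _ 2) ?nnegrE // real_normK ?num_real //.
rewrite -(@ler_pM2l _ l.+1%:R) ?ltr0n //.
apply: le_trans (energy0_le l); apply: le_trans (energy_le l x).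
by rewrite lerDl sqr_ge0.
Qed.

End HermiteFunctions.

(** * Cholesky factorization and eigenvalue bounds for quadratic forms *)

Section QuadraticForms.
Variable R : realType.

Lemma mx11_trE (A : 'M[R]_1) : A^T 0 0 = A 0 0.
Proof. by rewrite mxE. Qed.

Lemma mx11D (A B : 'M[R]_1) : (A + B) 0 0 = A 0 0 + B 0 0.
Proof. by rewrite mxE. Qed.

Lemma mx11B (A B : 'M[R]_1) : (A - B) 0 0 = A 0 0 - B 0 0.
Proof. by rewrite !mxE. Qed.

Lemma mx11Z (a : R) (A : 'M[R]_1) : (a *: A) 0 0 = a * A 0 0.
Proof. by rewrite mxE. Qed.

Lemma mx11_scalarE (a : R) : (a%:M : 'M[R]_1) 0 0 = a.
Proof. by rewrite mxE eqxx mulr1n. Qed.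

(** Induction on the size: splitting off the first row and column leaves the Schur complement
    [B - a^-1 u u^T], which is again symmetric and positive definite. *)
Lemma cholesky (k : nat) (A : 'M[R]_k) : A^T = A -> posdefmx A ->
  exists L : 'M[R]_k, A = L^T *m L.
Proof.
elim: k A => [|k IH]; first by move=> A _ _; exists 0; apply/matrixP => -[].
rewrite -[k.+1]/(1 + k)%N => A AT Apd.
pose a := ulsubmx A 0 0; pose u := dlsubmx A; pose B := drsubmx A.
have uT : ursubmx A = u^T by rewrite /u trmx_dlsub AT.
have ulE : ulsubmx A = a%:M by rewrite [LHS]mx11_scalar.
have AE : A = block_mx a%:M u^T u B by rewrite -ulE -uT submxK.
have BT : B^T = B by rewrite /B trmx_drsub AT.
have qE (t : R) (v : 'cV[R]_k) : let w := col_mx t%:M v in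
  (w^T *m A *m w) 0 0 = t ^+ 2 * a + 2 * t * (u^T *m v) 0 0 + (v^T *m B *m v) 0 0.
  move=> w; rewrite /w AE tr_col_mx mul_row_block mul_row_col tr_scalar_mx.
  rewrite -!scalar_mxM mulmxDl mulmxDl -!scalar_mxM !mul_scalar_mx.
  rewrite !mul_mx_scalar -!scalemxAl !(mx11D, mx11Z, mx11_scalarE).
  have -> : (v^T *m u) 0 0 = (u^T *m v) 0 0.
    by rewrite -[RHS]mx11_trE trmx_mul trmxK.
  by ring.
have a0 : 0 < a.
  have := Apd (col_mx 1%:M 0); rewrite qE !mulmx0 !mxE expr1n mul1r mulr0 !addr0.
  apply; apply/eqP => /matrixP /(_ 0 0); rewrite mxE.
  case: splitP => // i _; rewrite !mxE [i]ord1 eqxx /= => /eqP.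
  by rewrite oner_eq0.
pose S := B - a^-1 *: (u *m u^T).
have ST : S^T = S by rewrite /S linearB /= linearZ /= trmx_mul trmxK BT.
have Spd : posdefmx S.
  (* This [t] minimizes the form over the first coordinate; the minimum is the form of the Schur
     complement at [v]. *)
  move=> v v0; pose t := - (a^-1 * (u^T *m v) 0 0).
  have := Apd (col_mx t%:M v); rewrite qE.
  have -> : (v^T *m S *m v) 0 0 =
      (v^T *m B *m v) 0 0 - a^-1 * ((u^T *m v) 0 0) ^+ 2.
    rewrite /S mulmxBr mulmxBl -scalemxAr -scalemxAl mx11B mx11Z !mulmxA -(mulmxA _ u^T).
    rewrite [(v^T *m u *m _) 0 0]mxE big_ord1; congr (_ - _ * _).
    have -> : (v^T *m u) 0 0 = (u^T *m v) 0 0.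
      by rewrite -[RHS]mx11_trE trmx_mul trmxK.
    by rewrite expr2.
  move=> H; apply: lt_le_trans (H _) _.
    apply: contra v0 => /eqP w0; apply/eqP.
    by rewrite -(col_mxKd (t%:M : 'M[R]_1) v) w0 linear0.
  rewrite /t; set c := (u^T *m v) 0 0; rewrite le_eqVlt; apply/orP; left.
  by apply/eqP; field; rewrite gt_eqF.
have [L' SE] := IH S ST Spd.
exists (block_mx (Num.sqrt a)%:M ((Num.sqrt a)^-1 *: u^T) 0 L').
have sa : Num.sqrt a * Num.sqrt a = a by rewrite -expr2 sqr_sqrtr // ltW.
have sa0 : Num.sqrt a != 0 by rewrite gt_eqF // sqrtr_gt0.
rewrite tr_block_mx mulmx_block AE !trmx0 !mul0mx !addr0 tr_scalar_mx -scalar_mxM sa.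
rewrite mulmx0 addr0 mul_scalar_mx scalerA divff // scale1r linearZ /= trmxK.
rewrite mul_mx_scalar scalerA divff // scale1r -SE -scalemxAl -scalemxAr scalerA.
by rewrite -invfM sa /S addrC subrK.
Qed.

Lemma tr_mul_sqr (k : nat) (v : 'cV[R]_k) : (v^T *m v) 0 0 = \sum_i v i 0 ^+ 2.
Proof. by rewrite mxE; apply: eq_bigr => i _; rewrite mxE expr2. Qed.

Lemma qform_cont (k : nat) (A : 'M[R]_k) :
  continuous (fun x : 'rV[R]_k => (x *m A *m x^T) 0 0).
Proof.
rewrite (_ : (fun _ => _) = fun x : 'rV[R]_k =>
    \sum_j (\sum_i x 0 i * A i j) * x 0 j); last first.
  apply/funext => x; rewrite mxE; apply: eq_bigr => j _.
  by rewrite !mxE; congr (_ * _); apply: eq_bigr.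
have cC i : continuous (fun x : 'rV[R]_k => x 0 i) by move=> x; exact: coord_continuous.
apply: continuous_big => [|j _]; first exact: add_continuous.
have cS : continuous (fun x : 'rV[R]_k => \sum_i x 0 i * A i j).
  apply: continuous_big => [|i _ y]; first exact: add_continuous.
  by apply: continuousM; [exact: cC | exact: cst_continuous].
by move=> x; apply: continuousM; [exact: cS | exact: cC].
Qed.

(** The form attains its minimum [c] on the compact unit sphere, and the minimizer is an eigenvector
    for [c]; hence [m <= c]. *)
Lemma rayleigh (k : nat) (A : 'M[R]_k) (m : R) : A^T = A ->
  (forall l : R, eigenvalue A l -> m <= l) ->
  forall v : 'cV[R]_k, m * (v^T *m v) 0 0 <= (v^T *m A *m v) 0 0.
Proof.
move=> AT meig.
case: k A AT meig => [|k] A AT meig v.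
  by rewrite [v]flatmx0 !mulmx0 !mxE mulr0.
(* Row vectors, since [eigenvalue] refers to left eigenvectors. *)
pose q (B : 'M[R]_k.+1) (x : 'rV[R]_k.+1) : R := (x *m B *m x^T) 0 0.
pose S := [set x : 'rV[R]_k.+1 | q 1%:M x = 1].
have q1E x : q 1%:M x = \sum_i x 0 i ^+ 2.
  by rewrite /q mulmx1 mxE; apply: eq_bigr => i _; rewrite mxE expr2.
have Scl : closed S.
  have H := (continuous_closedP _).1 (@qform_cont k.+1 1%:M).
  by have := H _ (@closed_eq R 1); exact.
have Scomp : compact S.
  have := @rV_compact R k.+1 (fun=> `[-1, 1]%classic) (fun=> @segment_compact R (-1) 1).
  move=> Icomp; apply: (subclosed_compact Scl Icomp) => x; rewrite /S /= q1E => x1 i.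
  have : x 0 i ^+ 2 <= 1.
    by rewrite -x1 (bigD1 i) //= lerDl sumr_ge0 // => j _; apply: sqr_ge0.
  by rewrite in_itv /= => ?; apply/andP; split; nra.
have S0 : S !=set0.
  exists (delta_mx 0 0); rewrite /S /= q1E (bigD1 0) //= big1 ?addr0 => [|j j0].
    by rewrite mxE !eqxx expr1n.
  by rewrite mxE (negPf j0) andbF expr0n.
have [x0 /set_mem x0S x0min] := EVT_min_rV S0 Scomp
  (continuous_subspaceT (@qform_cont k.+1 A)).
pose c := q A x0.
have cmin w : c * q 1%:M w <= q A w.
  have [->|w0] := eqVneq w 0; first by rewrite /q !mul0mx mxE mulr0.
  have w1 : 0 < q 1%:M w.
    rewrite q1E lt_neqAle sumr_ge0 ?andbT => [|i _]; last exact: sqr_ge0.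
    apply: contra w0; rewrite eq_sym psumr_eq0 => [/allP w0|i _]; last exact: sqr_ge0.
    apply/eqP/rowP => i; rewrite mxE; apply/eqP.
    by rewrite -sqrf_eq0; apply: w0; rewrite mem_index_enum.
  have qZ B t : q B (t *: w) = t ^+ 2 * q B w.
    by rewrite /q linearZ /= -scalemxAr -!scalemxAl !mxE mulrA expr2.
  have := x0min ((Num.sqrt (q 1%:M w))^-1 *: w).
  rewrite -/(q A _) -/(q A _) -/c qZ exprVn sqr_sqrtr ?(ltW w1) // ler_pdivlMl // mulrC.
  by apply; apply/mem_set; rewrite /S /= qZ exprVn sqr_sqrtr ?(ltW w1) // mulVf ?gt_eqF.
pose B := A - c%:M.
have BT : B^T = B by rewrite /B linearB /= AT tr_scalar_mx.
have qB w : q B w = q A w - c * q 1%:M w.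
  rewrite /q /B mulmxBr mulmxBl mxE [in X in _ + X]mxE; congr (_ - _).
  by rewrite mul_mx_scalar -scalemxAl mxE mulmx1.
(* The form of [B] is nonnegative and vanishes at [x0]; a small move from [x0] against the direction
   [x0 *m B] would make it negative unless that vector is 0. *)
have x0B : x0 *m B = 0.
  pose y := x0 *m B.
  have y0 : 0 <= q 1%:M y by rewrite q1E sumr_ge0 // => i _; apply: sqr_ge0.
  have qy : 0 <= q B y by rewrite qB subr_ge0.
  have qxy t : 0 <= 2 * t * q 1%:M y + t ^+ 2 * q B y.
    have : 0 <= q B (x0 + t *: y) by rewrite qB subr_ge0.
    have -> : q B (x0 + t *: y) = q B x0 + 2 * t * q 1%:M y + t ^+ 2 * q B y.
      clearbody B; rewrite /q (_ : (x0 + t *: y)^T = x0^T + t *: y^T); last first.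
        by apply/matrixP => i j; rewrite !mxE.
      rewrite !mulmxDl !mulmxDr -!scalemxAl -!scalemxAr.
      rewrite -/y mulmx1.
      have yx : y *m B *m x0^T = y *m y^T.
        by rewrite -mulmxA; congr (_ *m _); rewrite /y trmx_mul BT.
      rewrite yx !(mx11D, mx11Z); ring.
    by rewrite [q B x0]qB x0S mulr1 subrr add0r.
  have : q 1%:M y = 0.
    (* The minimum over [t] would be at [- q 1%:M y / q B y]; adding 1 keeps the denominator
       positive, and the value is still negative unless [q 1%:M y = 0]. *)
    have := qxy (- (q 1%:M y / (q B y + 1))).
    set n := q 1%:M y in y0 *; set Q := q B y in qy *.
    have Q1 : 0 < Q + 1 by rewrite ltr_wpDl.
    have -> : 2 * - (n / (Q + 1)) * n + (- (n / (Q + 1))) ^+ 2 * Q =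
       - ((n / (Q + 1)) ^+ 2 * (Q + 2)) by field; rewrite gt_eqF.
    rewrite oppr_ge0 => nQ.
    have : (n / (Q + 1)) ^+ 2 = 0.
      apply/eqP; rewrite eq_le sqr_ge0 andbT.
      by rewrite -(@pmulr_lle0 _ (Q + 2)) // ltr_wpDl.
    by move/eqP; rewrite sqrf_eq0 mulf_eq0 invr_eq0 (gt_eqF Q1) orbF => /eqP.
  rewrite q1E => /eqP; rewrite psumr_eq0 => [/allP Y|i _]; last exact: sqr_ge0.
  apply/rowP => i; rewrite [RHS]mxE; apply/eqP.
  by rewrite -sqrf_eq0; apply: Y; rewrite mem_index_enum.
have mc : m <= c.
  apply/meig/eigenvalueP; exists x0.
    by apply/eqP; rewrite -subr_eq0 -mul_mx_scalar -mulmxBr x0B.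
  apply/eqP => x00; move: x0S; rewrite /S /= x00 /q !mul0mx mxE => /eqP.
  by rewrite eq_sym oner_eq0.
apply: le_trans (_ : c * (v^T *m v) 0 0 <= _).
  by apply: ler_wpM2r => //; rewrite tr_mul_sqr sumr_ge0 // => i _; apply: sqr_ge0.
by have := cmin v^T; rewrite /q trmxK mulmx1.
Qed.

(** With [w = A^-1 v] one has [m |w|^2 <= w^T A w = v^T w]; together with [0 <= |v - m w|^2] this
    gives [m v^T w <= |v|^2]. *)
Lemma qform_inv_le (k : nat) (A : 'M[R]_k) (m : R) : 0 < m ->
  (forall v : 'cV[R]_k, m * (v^T *m v) 0 0 <= (v^T *m A *m v) 0 0) ->
  A^T = A -> A \in unitmx ->
  forall v : 'cV[R]_k, (v^T *m invmx A *m v) 0 0 <= m^-1 * (v^T *m v) 0 0.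
Proof.
move=> m0 Am AT Au v; pose w := invmx A *m v.
have vE : v = A *m w by rewrite /w mulmxA mulmxV // mul1mx.
have -> : (v^T *m invmx A *m v) 0 0 = (w^T *m A *m w) 0 0.
  by rewrite {1}vE trmx_mul AT -!mulmxA -/w (mulmxA A).
have := Am w; set W := (w^T *m w) 0 0; set Q := (w^T *m A *m w) 0 0 => WQ.
set N := (v^T *m v) 0 0.
have sq_ge0 (u : 'cV[R]_k) : 0 <= (u^T *m u) 0 0.
  by rewrite tr_mul_sqr sumr_ge0 // => i _; apply: sqr_ge0.
have W0 : 0 <= W by apply: sq_ge0.
have wv : (w^T *m v) 0 0 = Q by rewrite vE mulmxA.
have vw : (v^T *m w) 0 0 = Q by rewrite -wv -[RHS]mx11_trE trmx_mul trmxK.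
have := sq_ge0 (v - m *: w).
rewrite (_ : (v - m *: w)^T = v^T - m *: w^T); last first.
  by apply/matrixP => i j; rewrite !mxE.
rewrite mulmxBl !mulmxBr -!scalemxAl -!scalemxAr.
rewrite !(mx11B, mx11Z) vw wv -/N -/W => H.
rewrite ler_pdivlMl //.
have : m * (m * W) <= m * Q by rewrite ler_pM2l.
by nra.
Qed.

Lemma posdef_unitmx (k : nat) (A : 'M[R]_k) : posdefmx A -> A \in unitmx.
Proof.
move=> Apd; rewrite -row_free_unit -kermx_eq0; apply/eqP/row_matrixP => i.
rewrite row0; apply/eqP/negPn/negP => ki.
have kT : (row i (kermx A))^T != 0.
  by apply/eqP => /(congr1 trmx); rewrite trmxK trmx0 => k0; rewrite k0 eqxx in ki.
by have := Apd _ kT; rewrite trmxK -row_mul mulmx_ker row0 mul0mx mxE ltxx.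
Qed.

Lemma posdef_invmx (k : nat) (A : 'M[R]_k) : A^T = A -> posdefmx A ->
  posdefmx (invmx A).
Proof.
move=> AT Apd x x0; have Au := posdef_unitmx Apd.
have -> : x^T *m invmx A *m x = (invmx A *m x)^T *m A *m (invmx A *m x).
  by rewrite trmx_mul trmx_inv AT -!mulmxA (mulmxA A) mulmxV // mul1mx.
apply: Apd; apply: contra x0 => /eqP Ax.
by rewrite -(mul1mx x) -(mulmxV Au) -mulmxA Ax mulmx0.
Qed.

End QuadraticForms.

(** * Combinatorial sums of Faa di Bruno's formula *)

Section FaaDiBruno.
Variable R : realType.

(* Number of compositions of [n] into [m] positive parts. *)
Definition ncomp (n m : nat) : nat :=
  match n, m with
  | 0, 0 => 1
  | n'.+1, m'.+1 => 'C(n', m')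
  | _, _ => 0
  end.

Lemma ncomp_small n m : (n < m)%N -> ncomp n m = 0%N.
Proof. by case: n m => [|n] [|m] //=; rewrite ltnS; exact: bin_small. Qed.

Lemma sum_ncomp n m : (\sum_(r < n.+1) ncomp r m = 'C(n, m))%N.
Proof.
elim: n m => [|n IH] [|m]; rewrite big_ord_recr /=.
- by rewrite big_ord0 bin0.
- by rewrite big_ord0 bin0n.
- by rewrite IH !bin0.
- by rewrite IH binS.
Qed.

(** [(n - r).+1] counts the [i] with [r <= i <= n], so this sums up the partial sums in
    [sum_ncomp]. *)
Lemma weighted_sum_ncomp n m :
  (\sum_(r < n.+1) (n - r).+1 * ncomp r m = 'C(n.+1, m.+1))%N.
Proof.
elim: n => [|n IH].
  by rewrite big_ord_recr big_ord0 /= subnn mul1n; case: m => [|[|m]].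
rewrite big_ord_recr /= subnn mul1n binS -IH -sum_ncomp.
rewrite [X in _ = (_ + X)%N]big_ord_recr /= addnA; congr addn; rewrite -big_split /=.
by apply: eq_bigr => i _; rewrite subSn ?(leq_ord i) // mulSn addnC.
Qed.

(* The partitions of [n] points into [m] blocks B, each weighted by the product of the
   #|B|!, add up to n!/m! * ncomp n m; the bounds r^m on the derivatives of the Gaussian,
   summed over the assignments of the blocks to the components of g, add up to
   r^m m! 'C(q + m - 1, m). *)
Definition fdb_sum (A r : R) (n q : nat) : R :=
  \sum_(m < n.+1) A ^+ m * r ^+ m * (ncomp n m)%:R * 'C((q + m).-1, m)%:R.

Lemma fdb_sum0 A r q : fdb_sum A r 0 q = 1.
Proof. by rewrite /fdb_sum big_ord_recr big_ord0 /= bin0 !expr0 !mulr1 add0r. Qed.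

Lemma fdb_sum_ge0 A r n q : 0 <= A -> 0 <= r -> 0 <= fdb_sum A r n q.
Proof.
by move=> A0 r0; apply: sumr_ge0 => m _; rewrite !mulr_ge0 // exprn_ge0.
Qed.

(** The recursion from removing the block of the last point, with [p] points outside it. The
    coefficients of [(A r)^(m+1)] agree by [weighted_sum_ncomp] and two absorption identities for
    binomials. *)
Lemma fdb_sum_rec A r n q :
  A * r * q%:R * (\sum_(p < n.+1) (n - p).+1%:R * fdb_sum A r p q.+1) =
  n.+1%:R * fdb_sum A r n.+1 q.
Proof.
(* Terms with [m > p] vanish, so the inner sums get a common range and the two sums can be
   exchanged. *)
have fE p : (p <= n)%N -> fdb_sum A r p q.+1 = \sum_(m < n.+1)
    A ^+ m * r ^+ m * (ncomp p m)%:R * 'C(q + m, m)%:R.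
  move=> pn; rewrite /fdb_sum -[RHS](big_mkord xpredT (fun m =>
    A ^+ m * r ^+ m * (ncomp p m)%:R * 'C(q + m, m)%:R)).
  rewrite (@big_cat_nat _ _ _ p.+1) //= [X in _ = _ + X]big_nat_cond.
  rewrite [X in _ = _ + X]big1 ?addr0 ?big_mkord // => m /andP[/andP[pm _] _].
  by rewrite ncomp_small // mulr0 mul0r.
rewrite (eq_bigr (fun p : 'I_n.+1 => \sum_(m < n.+1) A ^+ m * r ^+ m *
    ((n - p).+1 * ncomp p m)%:R * 'C(q + m, m)%:R)); last first.
  move=> p _; rewrite fE ?(leq_ord p) // mulr_sumr; apply: eq_bigr => m _.
  by rewrite natrM; ring.
rewrite exchange_big /= /fdb_sum [in RHS]big_ord_recl /= mulr0 mul0r add0r !mulr_sumr.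
apply: eq_bigr => m _.
rewrite -mulr_suml -mulr_sumr -natr_sum weighted_sum_ncomp /bump /= add1n addnS /=.
have E1 : n.+1%:R * 'C(n, m)%:R = m.+1%:R * 'C(n.+1, m.+1)%:R :> R.
  by rewrite -!natrM mul_bin_diag.
have E2 : q%:R * 'C(q + m, m)%:R = m.+1%:R * 'C(q + m, m.+1)%:R :> R.
  by rewrite -!natrM mul_bin_left addnK.
rewrite !exprS.
transitivity (A * A ^+ m * (r * r ^+ m) * 'C(n.+1, m.+1)%:R *
   (q%:R * 'C(q + m, m)%:R)); first by ring.
rewrite E2; transitivity (A * A ^+ m * (r * r ^+ m) * 'C(q + m, m.+1)%:R *
   (m.+1%:R * 'C(n.+1, m.+1)%:R)); first by ring.
by rewrite -E1; ring.
Qed.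

Lemma negbin_le (r : R) (q m : nat) : 0 <= r -> r < 1 ->
  r ^+ m * 'C((q + m).-1, m)%:R <= ((1 - r)^-1) ^+ q.
Proof.
move=> r0 r1; have i1 : 1 <= (1 - r)^-1 by rewrite invf_ge1 ?subr_gt0 //; lra.
case: q => [|q].
  rewrite add0n expr0; case: m => [|m]; first by rewrite bin0 mulr1.
  by rewrite bin_small // mulr0.
(* One term of the expansion of [((1 - r) + r)^(q + m) = 1] is at most 1; it yields the exponent
   [q], one less than claimed. *)
have: \sum_(i < (q + m).+1) ((1 - r) ^+ (q + m - i) * r ^+ i) *+ 'C(q + m, i) = 1.
  by rewrite -exprDn subrK expr1n.
have mq : (m < (q + m).+1)%N by rewrite ltnS leq_addl.
rewrite (bigD1 (Ordinal mq)) //= addnK => E.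
have: (1 - r) ^+ q * r ^+ m *+ 'C(q + m, m) <= 1.
  rewrite -[leRHS]E lerDl sumr_ge0 // => i _; rewrite mulrn_wge0 // mulr_ge0 ?exprn_ge0 //.
  by rewrite subr_ge0 ltW.
rewrite -mulr_natr -mulrA -ler_pdivlMl ?exprn_gt0 ?subr_gt0 // mulr1 => /le_trans; apply.
by rewrite -exprVn ler_weXn2l.
Qed.

(** The term [m = 0] vanishes, and as [1 <= A] all powers of [A] are bounded by the highest one. *)
Lemma fdb_sum_le (A r : R) (n q : nat) : 1 <= A -> 0 <= r -> r < 1 ->
  fdb_sum A r n.+1 q <= A ^+ n.+1 * 2 ^+ n * ((1 - r)^-1) ^+ q.
Proof.
move=> A1 r0 r1; rewrite /fdb_sum big_ord_recl /= mulr0 mul0r add0r.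
have -> : 2 ^+ n = \sum_(m < n.+1) 'C(n, m)%:R :> R.
  rewrite -[2]/(1 + 1) exprDn; apply: eq_bigr => i _.
  by rewrite !expr1n mulr1.
rewrite mulr_sumr mulr_suml; apply: ler_sum => m _; rewrite /bump /= add1n.
set B := 'C((_ + _).-1, _)%:R; set N := 'C(_, _)%:R.
have -> : A ^+ m.+1 * r ^+ m.+1 * N * B = A ^+ m.+1 * N * (r ^+ m.+1 * B) by ring.
apply: ler_pM; rewrite ?mulr_ge0 ?exprn_ge0 //; first lra.
  by apply: ler_wpM2r => //; rewrite ler_weXn2l.
exact: negbin_le.
Qed.

(** An equality for [beta = 1]; the remaining power [beta - 1] is handled by
    [r! (n - r + 1)! <= (n + 1)!]. It merges the factorials of a block and of its complement. *)
Lemma fact_pow_le (beta : R) (n r : nat) : 1 <= beta -> (r <= n)%N ->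
  n.+1%:R * ('C(n, r)%:R * (r`!%:R `^ beta * (n - r).+1`!%:R `^ beta)) <=
  (n - r).+1%:R * n.+1`!%:R `^ beta :> R.
Proof.
move=> b1 rn; set c := beta - 1.
have c0 : 0 <= c by rewrite /c; lra.
rewrite -powRM //.
have powE (N : nat) : (0 < N)%N -> N%:R `^ beta = N%:R * N%:R `^ c :> R.
  move=> N0; have -> : beta = 1 + c by rewrite /c; lra.
  by rewrite powRD ?powRr1 ?ler0n // pnatr_eq0 -lt0n N0 implybT.
rewrite -natrM !powE ?muln_gt0 ?fact_gt0 //.
set X := (r`! * _)%N.
have E : (n.+1 * ('C(n, r) * X) = (n - r).+1 * n.+1`!)%N.
  by rewrite /X factS (factS n) -(bin_fact rn); ring.
have XY : (X <= n.+1`!)%N.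
  have B : (0 < 'C(n.+1, r))%N by rewrite bin_gt0 leqW.
  by rewrite -(bin_fact (leqW rn)) subSn // leq_pmull.
clearbody X.
have -> : n.+1%:R * ('C(n, r)%:R * (X%:R * X%:R `^ c)) =
    (n.+1 * ('C(n, r) * X))%:R * X%:R `^ c :> R by rewrite !natrM !mulrA.
rewrite E natrM -mulrA.
apply: ler_wpM2l => //; apply: ler_wpM2l => //.
by apply: ge0_ler_powR; rewrite ?nnegrE ?ler0n // ler_nat.
Qed.
End FaaDiBruno.

(** * Derivatives of a product of Gaussians composed with [g] *)

Section GaussianComposition.
Variables (R : realType) (s k : nat) (g : 'I_k -> 'rV[R]_s -> R).
Implicit Types (x : 'rV[R]_s) (j : 'I_s) (js : seq 'I_s) (la : {ffun 'I_k -> nat}).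

Local Notation D := (@cube R s).

Lemma has_partial_prod (I : eqType) (r : seq I) (f : I -> 'rV[R]_s -> R)
    (f' : I -> R) x j : uniq r -> (forall i, has_partial (f i) x j (f' i)) ->
  has_partial (fun t => \prod_(i <- r) f i t) x j
    (\sum_(i <- r) \prod_(l <- r) if l == i then f' l else f l x).
Proof.
move=> + ff'; elim: r => [|i r IH].
  by under eq_fun do rewrite big_nil; rewrite big_nil => _; exact: has_partial_cst.
under eq_fun do rewrite big_cons.
rewrite cons_uniq big_cons => /andP[ir ur].
have := has_partialM (ff' i) (IH ur); congr has_partial.
rewrite [in RHS]big_cons eqxx; congr (_ * _ + _).
  apply: eq_big_seq => l lr; case: eqP => // li.
  by rewrite -li lr in ir.
rewrite mulr_sumr; apply: eq_big_seq => l lr; rewrite big_cons.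
by case: eqP => // il; rewrite il lr in ir.
Qed.

Definition mi_incr (i : 'I_k) la : {ffun 'I_k -> nat} := [ffun l => (la l + (l == i))%N].

(** Derivatives of such products are sums of such products times derivatives of [g], so the
    induction runs over all [la]; the Gaussian itself is [la = 0]. *)
Definition gauss_prod la (t : 'rV[R]_s) : R := \prod_i gauss (la i) (g i t).

Lemma has_partial_gauss_prod la x j (dg : 'I_k -> R) :
  (forall i, has_partial (g i) x j (dg i)) ->
  has_partial (gauss_prod la) x j (\sum_i gauss_prod (mi_incr i la) x * dg i).
Proof.
move=> gdg.
have := @has_partial_prod _ (index_enum 'I_k) _ _ x j (index_enum_uniq _)
  (fun i => has_partial_comp (is_derive_gauss (la i) (g i x)) (gdg i)).
congr has_partial; apply: eq_bigr => i _.
rewrite /gauss_prod (bigD1 i) //= eqxx [in RHS](bigD1 i) //= ffunE eqxx addn1.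
rewrite mulrAC; congr (_ * _ * _); apply: eq_bigr => l li.
by rewrite ffunE (negPf li) addn0.
Qed.

Hypothesis g_diff : forall i n, diff_upto n (g i).

Lemma diff_upto_gauss_prod n la : diff_upto n (gauss_prod la).
Proof.
elim: n la => // n IH la.
apply: (@diff_upto_step _ _ _ _
  (fun j t => \sum_i gauss_prod (mi_incr i la) t * partial D j (g i) t)).
  move=> j x Dx; apply: has_partial_gauss_prod => i.
  by have [+ _] := g_diff i 1; apply.
move=> j; apply: diff_upto_sum => i; apply: diff_uptoM; first exact: IH.
by have [_] := g_diff i n.+1; apply.
Qed.

Definition mi_gauss_bound (r : R) la : R := \prod_i ((la i)`!%:R * r ^+ la i).

(** Raising [la i] multiplies the bound by [r (la i + 1)]; summed over [i] this gives the factor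
    [r q] of [fdb_sum_rec] with [q = k + |la|]. *)
Lemma sum_mi_gauss_bound r la : \sum_i mi_gauss_bound r (mi_incr i la) =
  mi_gauss_bound r la * (r * (k + \sum_i la i)%:R).
Proof.
have E i : mi_gauss_bound r (mi_incr i la) = mi_gauss_bound r la * (r * (la i).+1%:R).
  rewrite /mi_gauss_bound (bigD1 i) //= [in RHS](bigD1 i) //= ffunE eqxx addn1.
  rewrite (eq_bigr (fun l => (la l)`!%:R * r ^+ la l)) => [|l li]; last first.
    by rewrite ffunE (negPf li) addn0.
  by rewrite factS natrM exprS; ring.
rewrite (eq_bigr _ (fun i _ => E i)).
rewrite -!mulr_sumr; congr (_ * (_ * _)).
rewrite -natr_sum; congr _%:R.
under eq_bigr do rewrite -add1n.
by rewrite big_split /= sum1_card card_ord.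
Qed.

Lemma mi_order_incr i la : (\sum_l mi_incr i la l = (\sum_l la l).+1)%N.
Proof.
under eq_bigr do rewrite ffunE.
rewrite big_split /= -addn1; congr addn.
by rewrite (bigD1 i) //= eqxx big1 // => l /negPf ->.
Qed.

Variables (b : nat -> R) (A beta : R).
Hypotheses (b_ge0 : forall j, 0 <= b j) (A_ge0 : 0 <= A) (beta_ge1 : 1 <= beta).

Local Notation r := (73%:R / 100%:R : R).

(* Differentiating along the last index of [js] first produces one factor
   [partial D j (g i)] and a product to which the Leibniz bound applies; the
   derivatives hitting that factor form the block of the last index in the
   set-partition form of Faa di Bruno's formula. *)
Lemma partials_gauss_prod_le x js la : D x ->
  (forall i js', subseq js' js -> js' != [::] ->
    `|partials js' (g i) x| <= A * (size js')`!%:R `^ beta * weight b js') ->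
  `|partials js (gauss_prod la) x| <=
  mi_gauss_bound r la * fdb_sum A r (size js) (k + \sum_i la i) *
  (size js)`!%:R `^ beta * weight b js.
Proof.
(* Strong induction on the length: the derivatives left on the product may form any shorter
   subsequence. *)
move=> Dx; have [n] := ubnP (size js); elim: n js la => // n IH js la.
have r0 : 0 <= r by lra.
case/lastP: js => [_ _|js j].
  rewrite fdb_sum0 /weight big_nil fact0 powR1 !mulr1 /= normr_prod.
  by apply: ler_prod => i _; rewrite normr_ge0 gauss_le.
rewrite size_rcons ltnS => jsn gb.
set N := size js in jsn *.
have dgp i m : diff_upto m (fun t => gauss_prod (mi_incr i la) t * partial D j (g i) t).
  apply: diff_uptoM; first exact: diff_upto_gauss_prod.
  by have [_] := g_diff i m.+1; apply.
rewrite partials_rcons.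
rewrite (_ : partials js _ x = \sum_i partials js (fun t =>
    gauss_prod (mi_incr i la) t * partial D j (g i) t) x); last first.
  rewrite -[RHS]partials_sum ?inE //; apply/esym/partials_ext; rewrite ?inE //.
    by apply: diff_upto_sum => i; apply: dgp.
  move=> y /set_mem Dy; apply/esym/has_partialE => //.
  by apply: has_partial_gauss_prod => i; have [+ _] := g_diff i 1; apply.
apply: le_trans (ler_norm_sum _ _ _) _.
have M0 la' : 0 <= mi_gauss_bound r la'.
  by apply: prodr_ge0 => i _; rewrite mulr_ge0 // exprn_ge0.
(* Raising one entry of [la] raises [q] by 1, hence the successor. *)
pose P p := fdb_sum A r p (k + \sum_i la i).+1.
have bnd i : `|partials js (fun t =>
      gauss_prod (mi_incr i la) t * partial D j (g i) t) x| <=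
    (\sum_(p < N.+1) 'C(N, p)%:R * ((mi_gauss_bound r (mi_incr i la) * P p *
      p`!%:R `^ beta) * (A * (N - p).+1`!%:R `^ beta * b j))) * weight b js.
  apply: (@partials_mul_le _ _ b x js _ _ (fun p => mi_gauss_bound r (mi_incr i la)
     * P p * p`!%:R `^ beta) (fun p => A * p.+1`!%:R `^ beta * b j)) => //.
  - exact: diff_upto_gauss_prod.
  - by have [_] := g_diff i N.+1; apply.
  - move=> js' ss; have := IH js' (mi_incr i la).
    rewrite mi_order_incr addnS -/(P _); apply.
      exact: leq_ltn_trans (size_subseq ss) jsn.
    move=> l js'' ss'; apply: gb.
    by apply: subseq_trans (subseq_trans ss' ss) (subseq_rcons _ _).
  - move=> js' ss; rewrite -partials_rcons.
    apply: le_trans (gb i _ (subseq_rcons_rcons j ss) _) _.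
      by rewrite -size_eq0 size_rcons.
    by rewrite size_rcons weight_rcons; lra.
apply: le_trans (ler_sum _ (fun i _ => bnd i)) _.
rewrite weight_rcons [weight _ _ * _]mulrC [leRHS]mulrA -mulr_suml.
apply: ler_wpM2r; first exact: weight_ge0.
rewrite exchange_big /=.
(* This produces the weights [(N - p).+1] of [fdb_sum_rec]. *)
have E p : (p <= N)%N -> 'C(N, p)%:R * (p`!%:R `^ beta * (N - p).+1`!%:R `^ beta) <=
    N.+1%:R^-1 * ((N - p).+1%:R * N.+1`!%:R `^ beta) :> R.
  by move=> pN; rewrite ler_pdivlMl ?ltr0n //; apply: fact_pow_le.
have P0 p : 0 <= P p by apply: fdb_sum_ge0.
apply: (@le_trans _ _ (\sum_(p < N.+1) (mi_gauss_bound r la * (r * (k + \sum_i la i)%:R))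
    * A * b j * P p * (N.+1%:R^-1 * ((N - p).+1%:R * N.+1`!%:R `^ beta)))).
  apply: ler_sum => p _; rewrite -sum_mi_gauss_bound.
  rewrite (eq_bigr (fun i => mi_gauss_bound r (mi_incr i la) * (A * b j * P p *
    ('C(N, p)%:R * (p`!%:R `^ beta * (N - p).+1`!%:R `^ beta))))); last first.
    by move=> i _; ring.
  rewrite -mulr_suml -!mulrA; apply: ler_wpM2l; first exact: sumr_ge0.
  do 3 (apply: ler_wpM2l => //).
  exact/E/leq_ord.
rewrite (eq_bigr (fun p : 'I_N.+1 => (mi_gauss_bound r la * b j * N.+1`!%:R `^ beta *
   N.+1%:R^-1 * (A * r * (k + \sum_i la i)%:R)) * ((N - p).+1%:R * P p))); last first.
  by move=> p _; ring.
rewrite -mulr_sumr -mulrA fdb_sum_rec le_eqVlt; apply/orP; left; apply/eqP.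
have: N.+1%:R != 0 :> R by rewrite pnatr_eq0.
move: (N.+1%:R : R) => c c0; by field.
Qed.

End GaussianComposition.

(** * Multi-indices as sorted lists of directions *)

Section MultiIndices.
Variable s : nat.
Implicit Types (nu : {ffun 'I_s -> nat}) (js : seq 'I_s).

Definition mi_seq nu : seq 'I_s := flatten [seq nseq (nu j) j | j <- enum 'I_s].

Lemma size_mi_seq nu : size (mi_seq nu) = mi_order nu.
Proof.
rewrite /mi_seq size_flatten /shape -map_comp sumnE big_map big_enum /=.
by apply: eq_bigr => j _; rewrite size_nseq.
Qed.

Lemma weight_mi_seq (R : realType) (b : nat -> R) nu : weight b (mi_seq nu) = mi_pow b nu.
Proof.
rewrite /weight /mi_seq big_flatten big_map big_enum /=.
by apply: eq_bigr => j _; rewrite big_nseq -Monoid.iteropE.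
Qed.

Lemma count_mi_seq nu j : count_mem j (mi_seq nu) = nu j.
Proof.
rewrite /mi_seq count_flatten -map_comp sumnE big_map big_enum /= (bigD1 j) //=.
rewrite count_nseq /= eqxx mul1n big1 ?addn0 // => i /negPf ij.
by rewrite count_nseq /= ij.
Qed.

Lemma mi_seq_pairwise nu : pairwise (fun i j : 'I_s => i <= j)%N (mi_seq nu).
Proof.
have : pairwise (fun i j : 'I_s => i < j)%N (enum 'I_s).
  rewrite -(pairwise_map val ltn) val_enum_ord -sorted_pairwise ?iota_ltn_sorted //.
  exact: ltn_trans.
rewrite /mi_seq; elim: (enum 'I_s) => //= i l IH /andP[/allP il /IH lP].
rewrite pairwise_cat lP andbT; apply/andP; split.
  apply/allrelP => x y; rewrite mem_nseq => /andP[_ /eqP ->] /flatten_mapP[j jl].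
  by rewrite mem_nseq => /andP[_ /eqP ->]; apply/ltnW/il.
by elim: (nu i) => //= n ->; rewrite all_nseq leqnn orbT.
Qed.

(* All blocks of a partition of [mi_seq nu] are again of the form [mi_seq nu']: bounds on
   derivatives taken in the fixed order of [mi_partial] suffice, and the symmetry of mixed
   derivatives is not needed. *)
Lemma subseq_mi_seq nu js : subseq js (mi_seq nu) ->
  js = mi_seq [ffun j => count_mem j js].
Proof.
move=> ss; have le_trans' : transitive (fun i j : 'I_s => i <= j)%N.
  by move=> ? ? ?; apply: leq_trans.
apply: (sorted_eq le_trans').
- by move=> i j /anti_leq /val_inj.
- by rewrite sorted_pairwise //; apply: subseq_pairwise ss (mi_seq_pairwise nu).
- by rewrite sorted_pairwise //; apply: mi_seq_pairwise.
- by apply/allP => j _ /=; rewrite count_mi_seq ffunE.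
Qed.

Lemma mi_partialE (R : realType) (V : normedModType R) nu (f : 'rV[R]_s -> V) :
  mi_partial (@cube R s) nu f = partials (mi_seq nu) f.
Proof.
rewrite /mi_partial /partials /mi_seq; elim: (enum 'I_s) => //= j l ->.
by rewrite foldr_cat; elim: (nu j) => //= n ->.
Qed.

End MultiIndices.

(** * Passage from vector-valued maps to real functions *)

Section LinearImages.
Variables (R : realType) (s : nat).
Local Notation D := (@cube R s).

Lemma diff_upto_linear (V : normedModType R) (h : V -> R) (f : 'rV[R]_s -> V) n :
  linear h -> continuous h -> smooth_on D f -> diff_upto n (fun t => h (f t)).
Proof.
move=> hl hc; elim: n f => // n IH f sf.
apply: (@diff_upto_step _ _ _ _ (fun j t => h (partial D j f t))) => [j x Dx|j].
  by apply: has_partial_linear hl (hc _) _; exact: ((sf [::]).2 j x Dx).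
by apply: IH => js; rewrite -foldr_rcons; apply: sf.
Qed.

Lemma partials_linear (V : normedModType R) (h : V -> R) (f : 'rV[R]_s -> V) js :
  linear h -> continuous h -> smooth_on D f ->
  {in D, partials js (fun t => h (f t)) =1 (fun t => h (partials js f t))}.
Proof.
move=> hl hc; elim/last_ind: js f => // js j IH f sf x Dx.
have sf' : smooth_on D (partial D j f) by move=> l; rewrite -foldr_rcons; apply: sf.
rewrite !partials_rcons -IH //; apply/esym/partials_ext => //.
  exact: diff_upto_linear.
move=> y /set_mem Dy; apply/esym/has_partialE => //.
by apply: has_partial_linear hl (hc _) _; exact: ((sf [::]).2 j y Dy).
Qed.

Lemma partials_cst (c : R) (js : seq 'I_s) : js != [::] ->
  {in D, partials js (fun=> c) =1 (fun=> 0)}.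
Proof.
case/lastP: js => // js j _ x Dx; rewrite partials_rcons -(partials0 js Dx).
apply/esym/partials_ext => //; first exact: diff_upto_cst.
by move=> y /set_mem Dy; apply/esym/has_partialE => //; apply: has_partial_cst.
Qed.

End LinearImages.

(** * The weighted norm as a sum of squares *)

Section WeightedNorm.
Variables (R : realType) (k : nat).

Lemma coord_linear (L : 'M[R]_k) i : linear (fun v : 'cV[R]_k => - (L *m v) i 0 : R).
Proof. move=> a u v; rewrite mulmxDr -scalemxAr /=.
rewrite [fun_of_matrix (_ + _) _ _]mxE [fun_of_matrix (a *: _) _ _]mxE /GRing.scale /=; ring.
Qed.

Lemma coord_mul_continuous (L : 'M[R]_k) i :
  continuous (fun v : 'cV[R]_k => - (L *m v) i 0 : R).
Proof.
under eq_fun do rewrite mxE; move=> v; apply: continuousN; move: v.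
apply: continuous_big => [|l _ v]; first exact: add_continuous.
by apply: continuousM; [exact: cst_continuous | exact: coord_continuous].
Qed.

(** [L] is the Cholesky factor of [invmx Gamma]. One square is at most the whole form, which is at
    most [mu^-1] times the squared Euclidean norm. *)
Lemma qform_inv_sqrtm (Gamma : 'M[R]_k) (mu : R) : Gamma^T = Gamma -> posdefmx Gamma ->
  0 < mu -> (forall l : R, eigenvalue Gamma l -> mu <= l) ->
  exists L : 'M[R]_k,
    (forall v, wnorm (invmx Gamma) v ^+ 2 = \sum_i (L *m v) i 0 ^+ 2) /\
    (forall v i, `|(L *m v) i 0| <= (Num.sqrt mu)^-1 * enorm v).
Proof.
move=> GT Gpd mu0 mule.
have GiT : (invmx Gamma)^T = invmx Gamma by rewrite trmx_inv GT.
have [L LE] := cholesky GiT (posdef_invmx GT Gpd); exists L.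
have qE (v : 'cV[R]_k) : (v^T *m invmx Gamma *m v) 0 0 = \sum_i (L *m v) i 0 ^+ 2.
  by rewrite LE -tr_mul_sqr trmx_mul !mulmxA.
split=> [v|v i].
  by rewrite /wnorm sqr_sqrtr qE // sumr_ge0 // => i _; apply: sqr_ge0.
rewrite -sqrtr_sqr -sqrtrV ?(ltW mu0) // /enorm -sqrtrM ?invr_ge0 ?(ltW mu0) //.
rewrite ler_sqrt; last first.
  by rewrite mulr_ge0 ?invr_ge0 ?(ltW mu0) // sumr_ge0 // => l _; apply: sqr_ge0.
rewrite -tr_mul_sqr.
apply: le_trans (qform_inv_le mu0 (rayleigh GT mule) GT (posdef_unitmx Gpd) v).
by rewrite qE (bigD1 i) //= lerDl sumr_ge0 // => l _; apply: sqr_ge0.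
Qed.

End WeightedNorm.

(** * Assembly of the estimate for one map [f] *)

Lemma expR_qform_partials_le (R : realType) (k s : nat) (Gamma : 'M[R]_k)
    (mu C beta : R) (b : nat -> R) (f : 'rV[R]_s -> 'cV[R]_k)
    (nu : {ffun 'I_s -> nat}) (theta : 'rV[R]_s) (y : 'cV[R]_k) :
  Gamma^T = Gamma -> posdefmx Gamma -> 0 < mu <= 1 ->
  (forall l : R, eigenvalue Gamma l -> mu <= l) ->
  1 <= C -> 1 <= beta -> (forall j, 0 <= b j) ->
  smooth_on (@cube R s) f -> cube theta ->
  (forall nu', enorm (mi_partial (@cube R s) nu' f theta)
       <= C * ((mi_order nu')`!%:R `^ beta) * mi_pow b nu') ->
  nu != [ffun _ => 0%N] ->
  `| mi_partial (@cube R s) nu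
       (fun t => expR (- (1 / 2) * wnorm (invmx Gamma) (y - f t) ^+ 2)) theta |
  <= (382%:R / 100%:R) ^+ k * C ^+ mi_order nu
     * 2 `^ (beta * ((mi_order nu)%:R - 1))
     * mu `^ (- ((mi_order nu)%:R / 2))
     * ((mi_order nu)`!%:R `^ beta) * mi_pow b nu.
Proof.
move=> GT Gpd /andP[mu0 mu1] mule C1 beta1 b0 sf Dth fb nu0.
have [L [wE Lle]] := qform_inv_sqrtm GT Gpd mu0 mule.
pose h i (v : 'cV[R]_k) : R := - (L *m v) i 0.
have hl i : linear (h i) := coord_linear L i.
have hc i : continuous (h i) := coord_mul_continuous (L := L) (i := i).
pose g i (t : 'rV[R]_s) := (L *m y) i 0 + h i (f t).
have gd i n : diff_upto n (g i).
  by apply: diff_uptoD; [exact: diff_upto_cst | exact: diff_upto_linear].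
have -> : (fun t => expR (- (1 / 2) * wnorm (invmx Gamma) (y - f t) ^+ 2)) =
    gauss_prod g [ffun=> 0%N].
  apply/funext => t; rewrite wE mulr_sumr expR_sum; apply: eq_bigr => i _.
  rewrite ffunE /gauss /= hornerC mul1r /g /h mulmxBr.
  by rewrite [fun_of_matrix (_ - _) _ _]mxE [fun_of_matrix (- _) _ _]mxE mul1r.
pose A := C * (Num.sqrt mu)^-1.
have sm0 : 0 < Num.sqrt mu by rewrite sqrtr_gt0.
(* [C >= 1] and [mu <= 1] enter here, as [fdb_sum_le] asks for [1 <= A]. *)
have A1 : 1 <= A.
  rewrite /A -[1]mulr1 ler_pM // invf_ge1 //.
  by rewrite -sqrtr1 ler_sqrt.
rewrite mi_partialE.
apply: le_trans (partials_gauss_prod_le gd b0 (le_trans ler01 A1) beta1 _ Dth _) _.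
  move=> i js ss js0.
  rewrite /g partialsD ?inE //; first last.
  - exact: diff_upto_linear.
  - exact: diff_upto_cst.
  (* At least one derivative is taken, which removes the constant [(L *m y) i 0]. *)
  rewrite partials_cst ?inE // add0r partials_linear ?inE // /h normrN.
  apply: le_trans (Lle _ _) _.
  have jsE := subseq_mi_seq ss; rewrite jsE -mi_partialE weight_mi_seq size_mi_seq.
  rewrite /A [C * _]mulrC -!mulrA; apply: ler_wpM2l; first by rewrite invr_ge0 ltW.
  by rewrite mulrA; exact: fb.
rewrite size_mi_seq weight_mi_seq.
apply: ler_wpM2r; first by apply: prodr_ge0 => j _; rewrite exprn_ge0.
apply: ler_wpM2r; first exact: powR_ge0.
have -> : mi_gauss_bound (73%:R / 100%:R) ([ffun=> 0%N] : {ffun 'I_k -> nat}) = 1 :> R.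
  by rewrite /mi_gauss_bound big1 // => i _; rewrite ffunE fact0 expr0 mulr1.
rewrite mul1r big1 ?addn0 => [|i _]; last by rewrite ffunE.
have : (0 < mi_order nu)%N.
  rewrite lt0n; apply: contra nu0; rewrite sum_nat_eq0 => /forallP nu0.
  by apply/eqP/ffunP => j; rewrite ffunE; apply/eqP/nu0.
case: (mi_order nu) => // n _.
apply: le_trans (fdb_sum_le n k A1 _ _) _; [lra | lra |].
have -> : n.+1%:R - 1 = n%:R :> R by rewrite -addn1 natrD addrK.
have -> : mu `^ (- (n.+1%:R / 2)) = ((Num.sqrt mu)^-1) ^+ n.+1.
  by rewrite powRN mulrC powRrM powR12_sqrt ?ltW // powR_mulrn ?sqrtr_ge0 // exprVn.
have -> : (382%:R / 100%:R) ^+ k * C ^+ n.+1 * 2 `^ (beta * n%:R) * (Num.sqrt mu)^-1 ^+ n.+1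
   = A ^+ n.+1 * 2 `^ (beta * n%:R) * (382%:R / 100%:R) ^+ k :> R.
  by rewrite /A [(C / _) ^+ _]exprMn; ring.
have A0 : 0 <= A by exact: le_trans ler01 A1.
apply: ler_pM; rewrite ?mulr_ge0 ?exprn_ge0 ?invr_ge0 //; first lra.
  apply: ler_wpM2l; first exact: exprn_ge0.
  (* As [beta >= 1], the sum [2 ^ n] of the binomials is at most [2 ^ (beta n)]. *)
  rewrite -powR_mulrn //; apply: ler_powR; first lra.
  by rewrite ler_peMl.
have -> : (1 - 73%:R / 100%:R)^-1 = 100%:R / 27%:R :> R by field.
suff: 100%:R / 27%:R <= 382%:R / 100%:R :> R.
  by move=> ?; apply: lerXn2r; rewrite ?nnegrE ?divr_ge0.
by clear; lra.
Qed.

Theorem lemma5p3 (R : realType) (k d : nat) (K : R) (Xi : set 'rV[R]_d)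
  (Gamma : 'M[R]_k) (mu_min C beta p : R) (b : nat -> R)
  (G : forall s : nat, 'rV[R]_s -> 'rV[R]_d -> 'cV[R]_k)
  (k_gt0 : (0 < k)%N) (K_gt0 : 0 < K)
  (Xi_compact : compact Xi)
  (Gamma_sym : Gamma^T = Gamma) (Gamma_posdef : posdefmx Gamma)
  (mu_min_bounds : 0 < mu_min <= 1)
  (mu_min_le_eig : forall l : R, eigenvalue Gamma l -> mu_min <= l)
  (C_ge1 : 1 <= C) (beta_ge1 : 1 <= beta)
  (p_bounds : 0 < p < 1)
  (b_ge0 : forall j : nat, 0 <= b j)
  (b_lp : cvgn (series (fun j : nat => b j `^ p)))
  (G_smooth : forall (s : nat) (xi : 'rV[R]_d), (0 < s)%N -> Xi xi ->
     smooth_on (@cube R s) (fun theta => G s theta xi))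
  (G_bound : forall (s : nat) (theta : 'rV[R]_s) (nu : {ffun 'I_s -> nat})
     (xi : 'rV[R]_d), (0 < s)%N -> cube theta -> Xi xi ->
     enorm (mi_partial (@cube R s) nu (fun t => G s t xi) theta)
       <= C * ((mi_order nu)`!%:R `^ beta) * mi_pow b nu) :
  forall (s : nat) (nu : {ffun 'I_s -> nat}), (0 < s)%N ->
  nu != [ffun _ => 0%N] ->
  forall (theta : 'rV[R]_s) (y : 'cV[R]_k) (xi : 'rV[R]_d),
  cube theta -> (forall i : 'I_k, - K <= y i 0 <= K) -> Xi xi ->
  `| mi_partial (@cube R s) nu
       (fun t => expR (- (1 / 2) * wnorm (invmx Gamma) (y - G s t xi) ^+ 2))
       theta |
  <= (382%:R / 100%:R) ^+ k * C ^+ mi_order nu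
     * 2 `^ (beta * ((mi_order nu)%:R - 1))
     * mu_min `^ (- ((mi_order nu)%:R / 2))
     * ((mi_order nu)`!%:R `^ beta) * mi_pow b nu.
Proof.
move=> s nu s0 nu0 theta y xi Dtheta _ Xxi.
apply: (expR_qform_partials_le y Gamma_sym Gamma_posdef mu_min_bounds) => //.
- exact: G_smooth.
- by move=> nu'; apply: G_bound.
Qed.
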